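(* Let $\mathbb{K}=\mathbb{R}$ or $\mathbb{C}$, let $n\ge 1$, and let $A$ and $B$ be $n\times n$ matrices over $\mathbb{K}$ such that $A$ is lower triangular and $B$ is diagonal. Write $A_i=A_{ii}$ and $B_i=B_{ii}$ for the diagonal entries. Suppose the following properties hold. (i) The diagonal entries of $A$ and $B$ satisfy $$0<|B_n|<\cdots<|B_2|<|B_1|<1<|A_1|<|A_2|<\cdots<|A_n|$$ and $$\left(\frac{B_n}{B_1},\frac{A_n}{A_1}\right)\prec\cdots\prec\left(\frac{B_2}{B_1},\frac{A_2}{A_1}\right)\prec(B_1,A_1)$$ (where for $n=1$ the second condition means that $(B_1,A_1)$ is a generating pair). (ii) The entries on the first column of $(A_1^{-1}A-I+\Delta)^{-1}$ are all non-zero. Then for every column vector $p=(p_1,\ldots,p_n)^T\in\mathbb{K}^n$ with $p_1\neq 0$, the orbit of $p$ under the action of the semigroup generated by $A$ and $B$ is dense in $\mathbb{K}^n$. In fact, the set $$\{B^{k_1}A^{l_1}\cdots B^{k_n}A^{l_n}p:\ k_i,l_i\ge 0 \text{ integers for all } i=1,\ldots,n\}$$ is dense in $\mathbb{K}^n$.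
   Context: $I$ is the $n\times n$ identity matrix, and $\Delta$ is the $n\times n$ matrix with $\Delta_{11}=1$ and $\Delta_{ij}=0$ for $(i,j)\ne(1,1)$. A pair $(a,b)\in\mathbb{K}^2$ is called generating if $|a|<|b|$ and $\{a^mb^n: m,n\in\mathbb{N}\}$ is dense in $\mathbb{K}$. One writes $(a,b)\prec(c,d)$ if and only if $(a,b)$ and $(c,d)$ are both generating pairs and $$\frac{\ln|a|}{\ln|b|}<\frac{\ln|c|}{\ln|d|}.$$ The orbit of $p$ under the semigroup $\Gamma$ generated by $A$ and $B$ (under matrix multiplication) is $\{Tp: T\in\Gamma\}$. *)

(* Defs.v *)
From HB Require Import structures.
From mathcomp Require Import all_boot all_order all_algebra.
From mathcomp Require Import all_classical all_reals all_analysis.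
From mathcomp Require Import complex.

Set Implicit Arguments.
Unset Strict Implicit.
Unset Printing Implicit Defensive.

Import Order.TTheory GRing.Theory Num.Theory.
Import numFieldNormedType.Exports.

Local Open Scope classical_set_scope.
Local Open Scope ring_scope.
Local Open Scope complex_scope.

Variant scalar_kind := RealScalars | ComplexScalars.

Definition base_field (R : realType) (k : scalar_kind) : numFieldType :=
  match k with RealScalars => R | ComplexScalars => R[i] end.

(* The norm of R[i] in the numFieldType hierarchy takes its values in R[i];
   logarithms need the modulus as an element of R. *)
Definition modulus (R : realType) (k : scalar_kind) : base_field R k -> R :=
  match k with
  | RealScalars => fun x : R => `|x|
  | ComplexScalars => fun z : R[i] => ComplexField.Normc.normc z
  end.
Arguments modulus {R k} _.

Definition generating_pair (R : realType) (k : scalar_kind)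
    (a b : base_field R k) : Prop :=
  modulus a < modulus b /\
  dense [set x : base_field R k | exists m n : nat, x = a ^+ m * b ^+ n].

Definition pair_prec (R : realType) (k : scalar_kind)
    (p q : base_field R k * base_field R k) : Prop :=
  [/\ generating_pair p.1 p.2, generating_pair q.1 q.2 &
      ln (modulus p.1) / ln (modulus p.2) <
      ln (modulus q.1) / ln (modulus q.2)].

(* The last pair of the chain, at ord0, is not normalized by the leading
   diagonal entries: it would be (1, 1). *)
Definition diag_pair (R : realType) (k : scalar_kind) (n : nat)
    (A B : 'M[base_field R k]_n.+1) (i : 'I_n.+1) :
    base_field R k * base_field R k :=
  if i == ord0 then (B ord0 ord0, A ord0 ord0)
  else (B i i / B ord0 ord0, A i i / A ord0 ord0).

(* A semigroup need not contain the identity matrix. *)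
Definition mx_semigroup (K : numFieldType) (n : nat) (G : set 'M[K]_n)
    : set 'M[K]_n :=
  smallest [set S | forall X Y, S X -> S Y -> S (X *m Y)] G.

Definition mx_orbit (K : numFieldType) (n : nat) (S : set 'M[K]_n)
    (p : 'cV[K]_n) : set 'cV[K]_n :=
  [set T *m p | T in S].

(* Main.v *)
Require Import Defs.
From HB Require Import structures.
From mathcomp Require Import all_boot all_order all_algebra.
From mathcomp Require Import all_classical all_reals all_analysis.
From mathcomp Require Import complex.
From mathcomp Require Import ring.

Set Implicit Arguments.
Unset Strict Implicit.
Unset Printing Implicit Defensive.

Import Order.TTheory GRing.Theory Num.Theory.
Import numFieldNormedType.Exports.

Local Open Scope classical_set_scope.
Local Open Scope ring_scope.

(** The density of the products comes from adding one coordinate per block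
    [B^k A^l].  Write A_i, B_i for the diagonal entries, and a_i = A_i / A_0,
    b_i = B_i / B_0 for the normalized ones.

    One block.  Since A is lower triangular with distinct diagonal entries,
    A = W D V where W is lower triangular with unit diagonal, V = W^-1 and D is
    diagonal ([trig_diagonalize]).  Hence the i-th coordinate of [B^k A^l y] is a
    combination of the monomials B_i^k A_s^l with s <= i
    ([trig_power_entry]).  The first column of W is the eigenvector of A for A_0
    normalized at its first entry, which is also the first column of the inverse
    in hypothesis (ii) ([first_col_invmx]); so none of its entries vanishes.

    Choice of exponents.  For an index m, the pair of index m is generating, so
    that there are exponents k, l tending to infinity along which its monomial
    tends to any prescribed t ([generating_seq]).  When t is not 0, l is then
    asymptotically proportional to k, the slope being determined by the quotient
    of logarithms; when t is 0, l grows at most at this rate.  Because these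
    quotients are strictly decreasing in the index, the monomials b_i^k a_i^l of
    larger index tend to 0 ([prec_cvg0]), and those of smaller index tend to
    infinity when t is not 0 ([prec_cvgV0]).

    Induction.  Let S_m be the set of points reached from p by m blocks with
    positive exponents ([layer]).  The claim is that the closure of S_(m+1)
    contains every vector supported on the coordinates 0..m.  The first block,
    with exponents adapted to index 0, contracts p onto an arbitrary multiple of
    the first basis vector ([first_step_cvg]).  For the next block, adapted to
    index m, one looks for a vector y supported on the coordinates below m that
    [B^k A^l] sends close to the target x.  The coordinates of [B^k A^l y]
    below m can be prescribed since the leading block of A is invertible, and
    such a y is dominated by a multiple of the first column of W
    truncated below m.  The truncation error starts with minus the m-th entry of that
    column; it is this nonzero error that A^l amplifies and
    that, thanks to the choice of t, produces the m-th coordinate of x, while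
    everything of larger index is killed by B^k ([next_step_cvg]).
    After n + 1 blocks every vector is in the closure. *)

(** * The modulus and the topology of the scalar field *)

Section Modulus.
Variables (R : realType) (k : scalar_kind).
Local Notation K := (base_field R k).
Implicit Types x y : K.

Lemma modulus_lt x y : (modulus x < modulus y) = (`|x| < `|y|).
Proof. by case: k x y => //= x y; rewrite ltcR. Qed.

Lemma modulusM x y : modulus (x * y) = modulus x * modulus y.
Proof.
by case: k x y => /= x y; [exact: normrM|exact: ComplexField.Normc.normcM].
Qed.

Lemma modulus1 : modulus (1 : K) = 1.
Proof.
by case: k => /=; [exact: normr1|exact: ComplexField.Normc.normc1].
Qed.

Lemma modulusV x : modulus x^-1 = (modulus x)^-1.
Proof.
by case: k x => /= x; [exact: normfV|exact: ComplexField.Normc.normcV].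
Qed.

Lemma modulus_ge0 x : 0 <= modulus x.
Proof.
by case: k x => /= x; [exact: normr_ge0|rewrite -lecR; exact: (normr_ge0 x)].
Qed.

Lemma modulus_eq0 x : (modulus x == 0) = (x == 0).
Proof.
case: k x => /= x; first exact: normr_eq0.
by rewrite -(inj_eq (@complexI R)); exact: (normr_eq0 x).
Qed.

Lemma modulusN x : modulus (- x) = modulus x.
Proof. by apply/eqP; rewrite eq_le !leNgt !modulus_lt normrN ltxx. Qed.

Lemma modulusX x n : modulus (x ^+ n) = modulus x ^+ n.
Proof. by elim: n => [|n IH]; rewrite ?modulus1 // !exprS modulusM IH. Qed.

(** The balls of the complex field have their radii in the complex field itself,
    but positive complex numbers are real; this lets every later estimate be made
    in the real field, for both kinds of scalars at once. *)
Lemma nbhs_modulus x (P : set K) :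
  nbhs x P <-> exists2 e : R, 0 < e & forall y, modulus (x - y) < e -> P y.
Proof.
split.
- move=> /nbhs_ballP[e e0 eP].
  case: k x P e e0 eP => /= x P e e0 eP; first by exists e => // y ye; apply: eP.
  have [e0' eE] : 0 < complex.Re e /\ e = (complex.Re e)%:C%C.
    by move: e0; case: e {eP} => a b; rewrite /= ltcE /= => /andP[/eqP -> ->].
  exists (complex.Re e) => // y ye; apply: eP; rewrite eE.
  by rewrite /ball /= -[X in X < _]/((ComplexField.Normc.normc _)%:C)%C ltcR.
- move=> [e e0 eP]; apply/nbhs_ballP.
  case: k x P e e0 eP => /= x P e e0 eP; first by exists e => // y ye; apply: eP.
  exists e%:C%C => /=; first by rewrite ltcR.
  move=> y; rewrite /ball /=.
  rewrite -[X in X < _]/((ComplexField.Normc.normc _)%:C)%C ltcR.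
  exact: eP.
Qed.

Lemma cvg_modulus0 (f : nat -> K) :
  modulus (f q) @[q --> \oo] --> (0 : R) -> f q @[q --> \oo] --> (0 : K).
Proof.
move=> /cvgr0Pnorm_lt f0 P /nbhs_modulus[e e0 eP].
have := f0 e e0.
apply: filterS => q /=; rewrite ger0_norm ?modulus_ge0// => fe; apply: eP.
by rewrite sub0r modulusN.
Qed.

Lemma cvg_modulus_bounded (f : nat -> K) y : f q @[q --> \oo] --> y ->
  exists M : R, \forall q \near \oo, modulus (f q) <= M.
Proof.
move=> fy.
exists (modulus (`|y| + 1)).
have fy1 : \forall q \near \oo, modulus (y - f q) < 1.
  by apply: (fy [set z | modulus (y - z) < 1]); apply/nbhs_modulus; exists 1.
near=> q; have : modulus (y - f q) < 1 by near: q.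
rewrite -[ltRHS]modulus1 modulus_lt normr1 => fq.
apply: ltW; rewrite modulus_lt [ltRHS]ger0_norm ?addr_ge0//.
rewrite -ltrBlDl; apply: le_lt_trans fq; rewrite distrC.
by rewrite lerBlDr; apply: le_trans (ler_normD _ _); rewrite subrK.
Unshelve. all: by end_near. Qed.

(** Density alone provides small exponents; approximating t / (b a)^(q+1)
    instead of t, and multiplying back, forces both exponents beyond q. *)
Lemma generating_seq (b a t : K) : b != 0 -> a != 0 -> generating_pair b a ->
  exists kl : nat -> nat * nat,
    (forall q, (q < (kl q).1)%N && (q < (kl q).2)%N) /\
    b ^+ (kl q).1 * a ^+ (kl q).2 @[q --> \oo] --> t.
Proof.
move=> b0 a0 [_ dab].
have step (q : nat) : {kl : nat * nat | (q < kl.1)%N && (q < kl.2)%N &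
    modulus (b ^+ kl.1 * a ^+ kl.2 - t) <= q.+1%:R^-1}.
  apply: cid2.
  set c := b ^+ q.+1 * a ^+ q.+1.
  have c0 : c != 0 by rewrite mulf_neq0 ?expf_neq0.
  have mc0 : 0 < modulus c by rewrite lt_neqAle eq_sym modulus_eq0 c0 modulus_ge0.
  pose O : set K := [set y | modulus (t / c - y) < q.+1%:R^-1 / modulus c].
  have Onbhs : nbhs (t / c) O.
    apply/nbhs_modulus; exists (q.+1%:R^-1 / modulus c) => //.
    by rewrite divr_gt0.
  have On : O° !=set0 by exists (t / c).
  have [y [Oy [m [n yE]]]] := dab O° On (open_interior O).
  rewrite {y}yE in Oy.
  have {}Oy := interior_subset Oy.
  exists (m + q.+1, n + q.+1)%N => /=; first by rewrite !ltn_addl.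
  have -> : b ^+ (m + q.+1) * a ^+ (n + q.+1) - t =
            - c * (t / c - b ^+ m * a ^+ n).
    rewrite mulNr -mulrN opprB mulrBr [c * (t / c)]mulrC divfK//.
    by rewrite !exprD mulrACA -/c mulrC.
  rewrite modulusM modulusN mulrC -ler_pdivlMr//; exact: ltW.
exists (fun q => s2val (step q)); split => [q|]; first by case: (step q).
apply/subr_cvg0/cvg_modulus0.
apply: (@squeeze_cvgr _ _ _ _ (fun=> 0) (fun q => q.+1%:R^-1)).
- by apply: nearW => q; rewrite modulus_ge0/=; case: (step q).
- exact: cvg_cst.
- exact: cvg_harmonic.
Qed.

End Modulus.

Lemma cvg_expr_modulus (R : realType) (k : scalar_kind) (z : base_field R k)
    (e : nat -> nat) :
  modulus z < 1 -> (forall q, q < e q)%N ->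
  z ^+ e q @[q --> \oo] --> (0 : base_field R k).
Proof.
move=> z1 eq; apply: cvg_modulus0.
apply: (@squeeze_cvgr _ _ _ _ (fun=> 0) (fun q => modulus z ^+ q)).
- apply: nearW => q; rewrite modulus_ge0 modulusX /=.
  by apply: ler_wiXn2l; rewrite ?modulus_ge0// ?(ltW z1)// ltnW.
- exact: cvg_cst.
- by apply: cvg_expr; rewrite ger0_norm ?modulus_ge0.
Qed.

(** * Comparison of the monomials of two pairs *)

(** The number theta is the exponent with w' = w^theta, and
    r = x' / x^theta < 1; then x'^k w'^l is the theta-th power of the bounded
    quantity x^k w^l times the geometric factor r^k. *)
Lemma cvg_geometric_domination (R : realType) (x w x' w' theta M : R)
    (k l : nat -> nat) :
  0 < x -> 0 < w -> 0 < x' -> 0 < w' -> 0 <= theta ->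
  ln w' = theta * ln w -> ln x' < theta * ln x ->
  (forall q, q < k q)%N ->
  (\forall q \near \oo, x ^+ k q * w ^+ l q <= M) ->
  x' ^+ k q * w' ^+ l q @[q --> \oo] --> (0 : R).
Proof.
move=> x0 w0 x'0 w'0 th0 lnw lnx kq xwM.
have [] : [/\ 0 <= x, 0 <= w, 0 <= x' & 0 <= w'] by split; exact: ltW.
move=> x0' w0' x'0' w'0'.
have powX (y : R) n : 0 < y -> (y ^+ n) `^ theta = (y `^ theta) ^+ n.
  by move=> y0; rewrite -!powR_mulrn ?powR_ge0 ?(ltW y0)// powRAC.
have w'E : w' = w `^ theta.
  by rewrite /powR gt_eqF// -lnw lnK// posrE.
have xth0 : 0 < x `^ theta by rewrite powR_gt0.
pose r := x' / x `^ theta.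
have r0 : 0 < r by rewrite divr_gt0.
have r0' := ltW r0.
have r1 : r < 1.
  by rewrite ltr_pdivrMr// mul1r /powR gt_eqF// -(lnK x'0) ltr_expR.
apply: (@squeeze_cvgr _ _ _ _ (fun=> 0) (fun q => M `^ theta * r ^+ q)).
- near=> q; rewrite mulr_ge0 ?exprn_ge0//=.
  have -> : x' ^+ k q * w' ^+ l q = (x ^+ k q * w ^+ l q) `^ theta * r ^+ k q.
    rewrite powRM ?exprn_ge0// !powX// -w'E mulrAC -exprMn.
    by rewrite [_ * r]mulrC divfK// gt_eqF.
  apply: ler_pM; rewrite ?powR_ge0 ?exprn_ge0//.
    apply: ge0_ler_powR => //.
    + by rewrite nnegrE mulr_ge0 ?exprn_ge0.
    + rewrite nnegrE; apply: (@le_trans _ _ (x ^+ k q * w ^+ l q)).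
        by rewrite mulr_ge0 ?exprn_ge0.
      by near: q.
    + by near: q.
  by apply: ler_wiXn2l; rewrite ?(ltW r1)// ltnW.
- exact: cvg_cst.
- rewrite -[X in _ --> X](mulr0 (M `^ theta)).
  apply: cvgM; first exact: cvg_cst.
  by apply: cvg_expr; rewrite ger0_norm.
Unshelve. all: by end_near. Qed.

Section Precedence.
Variables (R : realType) (k : scalar_kind).
Local Notation K := (base_field R k).
Variables (b a b' a' t : K) (kl : nat -> nat * nat).
Hypotheses (b0 : 0 < modulus b) (a1 : 1 < modulus a).
Hypotheses (b'0 : 0 < modulus b') (a'1 : 1 < modulus a').
Hypothesis prec : ln (modulus b') / ln (modulus a') <
                  ln (modulus b) / ln (modulus a).
Hypothesis klq : forall q, (q < (kl q).1)%N && (q < (kl q).2)%N.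

Let lna : 0 < ln (modulus a). Proof. exact: ln_gt0. Qed.
Let lna' : 0 < ln (modulus a'). Proof. exact: ln_gt0. Qed.
Let a0 : 0 < modulus a. Proof. exact: lt_trans a1. Qed.
Let a'0 : 0 < modulus a'. Proof. exact: lt_trans a'1. Qed.
Let klq1 q : (q < (kl q).1)%N. Proof. by case/andP: (klq q). Qed.

Lemma prec_cvg0 :
  b ^+ (kl q).1 * a ^+ (kl q).2 @[q --> \oo] --> t ->
  b' ^+ (kl q).1 * a' ^+ (kl q).2 @[q --> \oo] --> (0 : K).
Proof.
move=> /cvg_modulus_bounded[M bM]; apply: cvg_modulus0.
under eq_fun do rewrite modulusM !modulusX.
apply: (@cvg_geometric_domination _ (modulus b) (modulus a) _ _
  (ln (modulus a') / ln (modulus a)) M) => //.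
- by rewrite ltW// divr_gt0.
- by rewrite divfK// gt_eqF.
- by rewrite mulrAC -mulrA -ltr_pdivrMl// mulrC.
- by apply: filterS bM => q; rewrite modulusM !modulusX.
Qed.

(** The comparison applied to the inverses of the four numbers: inverting both
    members of a pair leaves the quotient of logarithms unchanged. *)
Lemma prec_cvgV0 : t != 0 ->
  b' ^+ (kl q).1 * a' ^+ (kl q).2 @[q --> \oo] --> t ->
  (b ^+ (kl q).1 * a ^+ (kl q).2)^-1 @[q --> \oo] --> (0 : K).
Proof.
move=> t0 /(cvgV t0) /cvg_modulus_bounded[M bM]; apply: cvg_modulus0.
under eq_fun do rewrite invfM modulusM -!exprVn !modulusX !modulusV.
apply: (@cvg_geometric_domination _ (modulus b')^-1 (modulus a')^-1 _ _
  (ln (modulus a) / ln (modulus a')) M); rewrite ?invr_gt0//.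
- by rewrite ltW// divr_gt0.
- by rewrite !lnV ?posrE// mulrN divfK// gt_eqF.
- by rewrite !lnV ?posrE// mulrN ltrN2 mulrAC -mulrA -ltr_pdivlMl// [ltRHS]mulrC.
- by apply: filterS bM => q; rewrite invfM modulusM -!exprVn !modulusX !modulusV.
Qed.

End Precedence.

(** * Limits of matrices *)

Lemma cvg_mx (T : topologicalType) (I : Type) (F : set_system I) {FF : Filter F}
    (m n : nat) (f : I -> 'M[T]_(m, n)) (x : 'M[T]_(m, n)) :
  (forall i j, f q i j @[q --> F] --> x i j) -> f q @[q --> F] --> x.
Proof.
move=> fx A [P xP PA].
have : \forall q \near F, forall i j, P i j (f q i j).
  by apply: filter_forall => i; apply: filter_forall => j; exact: fx (xP i j).
by apply: filterS => q /PA.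
Qed.

Lemma mulmx_continuous (K : numFieldType) (m n r : nat) (M : 'M[K]_(m, n)) :
  continuous (mulmx M : 'M[K]_(n, r) -> 'M[K]_(m, r)).
Proof.
move=> y; apply: (@cvg_mx _ _ (nbhs y)) => i j; rewrite mxE.
under eq_fun do rewrite mxE.
apply: (@cvg_big _ _ +%R 0) => [|s _]; first exact: add_continuous.
apply: cvgM; [exact: cvg_cst|exact: coord_continuous].
Qed.

Lemma closure_mulmx (K : numFieldType) (m n r : nat) (M : 'M[K]_(m, n))
    (S : set 'M[K]_(n, r)) (y : 'M[K]_(n, r)) :
  closure S y -> closure [set M *m z | z in S] (M *m y).
Proof.
move=> Sy A /mulmx_continuous yA; have [z [Sz Az]] := Sy _ yA.
by exists (M *m z); split => //; exists z.
Qed.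

Lemma closure_seq (T : topologicalType) (S : set T) (f : nat -> T) (x : T) :
  (forall q, closure S (f q)) -> f q @[q --> \oo] --> x -> closure S x.
Proof.
move=> Sf; apply: (closed_cvg (closure S)); first exact: closed_closure.
exact: nearW.
Qed.

(** * Diagonalization of triangular matrices *)

(** By induction on the size: below the first diagonal entry a, the first
    eigenvector solves (a - D') v = c, where c is the rest of the first column
    and D' the remaining block; a - D' is invertible as the diagonal entries are
    distinct.  The inverse V is built along with W so that its triangularity
    comes for free. *)
Lemma trig_diagonalize (F : fieldType) (n : nat) (A : 'M[F]_n) :
  is_trig_mx A -> (forall i j : 'I_n, (i < j)%N -> A i i != A j j) ->
  exists W V : 'M[F]_n,
    [/\ is_trig_mx W /\ is_trig_mx V, forall i, W i i = 1, forall i, V i i = 1,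
        V *m W = 1%:M & A *m W = W *m diag_mx (\row_i A i i)].
Proof.
elim: n A => [|n IH] A trigA dA.
  exists 1%:M, 1%:M; split; rewrite ?scalar_mx_is_trig ?mul1mx//; try by case.
  by apply/matrixP => -[].
pose A' : 'M[F]_(1 + n) := A; pose D' := drsubmx A'; pose a := A ord0 ord0.
pose c := dlsubmx A'.
have ulA : ulsubmx A' = a%:M.
  apply/matrixP => i j; rewrite !ord1 !mxE eqxx /=.
  by congr (A _ _); apply/val_inj.
have AE : A' = block_mx a%:M 0 c D'.
  rewrite -[LHS]submxK ulA; congr (block_mx _ _ _ _).
  apply/matrixP => i j; rewrite !mxE.
  by apply: (is_trig_mxP trigA); rewrite /= ord1.
have D'E i : D' i i = A (lift ord0 i) (lift ord0 i).
  by rewrite /D' !mxE; congr (A _ _); apply/val_inj.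
have trigD' : is_trig_mx D'.
  have : is_trig_mx A' by exact: trigA.
  by rewrite AE is_trig_block_mx// => /and3P[].
have [|W [V [[trigW trigV] W1 V1 VW DW]]] := IH D' trigD'.
  by move=> i j ij; rewrite !D'E; apply: dA.
have aD : a%:M - D' \in unitmx.
  rewrite unitmxE unitfE det_trig; last first.
    apply/is_trig_mxP => i j ij.
    rewrite mxE [(- D') i j]mxE (is_trig_mxP trigD')// [(a%:M) i j]mxE.
    by rewrite -val_eqE /= ltn_eqF// mulr0n subr0.
  apply/prodf_neq0 => i _; rewrite mxE [(a%:M) _ _]mxE eqxx.
  rewrite [(- D') _ _]mxE D'E subr_eq0.
  exact: dA.
pose v := invmx (a%:M - D') *m c.
have trig1 (u : 'cV[F]_n) (X : 'M[F]_n) : is_trig_mx X ->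
    is_trig_mx (block_mx (1%:M : 'M[F]_1) 0 u X).
  by move=> trigX; rewrite is_trig_block_mx// eqxx scalar_mx_is_trig.
have diag1 (u : 'cV[F]_n) (X : 'M[F]_n) : (forall i, X i i = 1) ->
    forall i, block_mx (1%:M : 'M[F]_1) 0 u X i i = 1.
  move=> X1 i; have [r ->|r ->] := split_ordP i; last by rewrite block_mxEdr.
  by rewrite block_mxEul mxE eqxx.
have inv1 : block_mx (1%:M : 'M[F]_1) 0 (- (V *m v)) V *m
    block_mx (1%:M : 'M[F]_1) 0 v W = 1%:M.
  rewrite mulmx_block !mul0mx !mulmx0 !mul1mx !mulmx1 !add0r !addr0 VW.
  by rewrite addNr -scalar_mx_block.
have conj1 : A' *m block_mx (1%:M : 'M[F]_1) 0 v W =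
    block_mx (1%:M : 'M[F]_1) 0 v W *m
    block_mx (a%:M : 'M[F]_1) 0 0 (diag_mx (\row_i D' i i)).
  rewrite AE !mulmx_block !mul0mx !mulmx0 !mul1mx !mulmx1 !add0r !addr0 DW.
  congr (block_mx _ _ _ _); rewrite mul_mx_scalar.
  by rewrite -[X in X + _](mulKVmx aD c) -/v mulmxBl mul_scalar_mx subrK.
have diagE : diag_mx (\row_i A i i) =
    block_mx (a%:M : 'M[F]_1) 0 0 (diag_mx (\row_i D' i i)).
  have -> : (a%:M : 'M[F]_1) = diag_mx (const_mx a) by rewrite diag_const_mx.
  rewrite -diag_mx_row; congr diag_mx.
  suff : \row_(i < 1 + n) A' i i = row_mx (const_mx a) (\row_i D' i i) by [].
  apply/rowP => i; have [r ->|r ->] := split_ordP i.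
    by rewrite row_mxEl !mxE ord1; congr (A _ _); apply/val_inj.
  by rewrite row_mxEr !mxE.
exists (block_mx 1%:M 0 v W), (block_mx 1%:M 0 (- (V *m v)) V); split.
- by split; apply: trig1.
- exact: diag1.
- exact: diag1.
- exact: inv1.
- by rewrite diagE; exact: conj1.
Qed.

Lemma trig_power_entry (F : fieldType) (n : nat) (A B W V : 'M[F]_n.+1)
    (k l : nat) (y : 'cV[F]_n.+1) (i : 'I_n.+1) :
  is_diag_mx B -> V *m W = 1%:M ->
  A *m W = W *m diag_mx (\row_i A i i) ->
  (B ^+ k *m (A ^+ l *m y)) i ord0 =
  \sum_s (B i i ^+ k * A s s ^+ l * W i s * \sum_j V s j * y j ord0).
Proof.
move=> /is_diag_mxP dB VW AW.
have Bk (z : 'cV_n.+1) : (B ^+ k *m z) i ord0 = B i i ^+ k * z i ord0.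
  elim: k => [|k IH]; first by rewrite !expr0 mul1mx mul1r.
  rewrite exprS -mulmxE -mulmxA mxE (bigD1 i)//= big1 ?addr0.
    by rewrite IH mulrA -exprS.
  by move=> j ji; rewrite dB ?mul0r// eq_sym.
have Al : A ^+ l *m W = W *m diag_mx (\row_i A i i ^+ l).
  elim: l => [|l IH].
    rewrite expr0 mul1mx -[LHS]mulmx1; congr (W *m _).
    by apply/matrixP => a b; rewrite !mxE expr0.
  rewrite exprS -mulmxE -mulmxA IH mulmxA AW -mulmxA mulmx_diag.
  congr (W *m diag_mx _); apply/rowP => j; by rewrite !mxE exprS.
have -> : A ^+ l = W *m diag_mx (\row_i A i i ^+ l) *m V.
  by rewrite -Al -mulmxA (mulmx1C VW) mulmx1.
rewrite Bk -!mulmxA mxE mulr_sumr; apply: eq_bigr => s _.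
rewrite mul_diag_mx mxE [(V *m y) _ _]mxE mxE; ring.
Qed.

(** The matrix in hypothesis (ii) sends the first column c of W to the first basis
    vector: A_0^-1 A fixes c, so A_0^-1 A - 1 kills it, and delta extracts its
    first entry, which is 1. *)
Lemma first_col_invmx (F : fieldType) (n : nat) (A W : 'M[F]_n.+1) :
  is_trig_mx A -> A ord0 ord0 != 0 ->
  (forall i, i != ord0 -> A i i != A ord0 ord0) ->
  A *m W = W *m diag_mx (\row_i A i i) -> W ord0 ord0 = 1 ->
  forall i, W i ord0 =
    invmx ((A ord0 ord0)^-1 *: A - 1%:M + delta_mx ord0 ord0) i ord0.
Proof.
move=> trigA a0 dA AW W1 i; set M := _ + delta_mx _ _.
have uM : M \in unitmx.
  rewrite unitmxE unitfE det_trig; last first.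
    apply/is_trig_mxP => s r sr; rewrite !mxE [A s r](is_trig_mxP trigA)// mulr0.
    have /negbTE nsr : s != r by rewrite -val_eqE /= ltn_eqF.
    have /negbTE r0 : r != ord0 by rewrite -val_eqE /= -lt0n (leq_ltn_trans _ sr).
    by rewrite nsr r0 andbF subr0 addr0.
  apply/prodf_neq0 => s _; rewrite !mxE eqxx andbb.
  have [->|s0] := eqVneq s ord0; first by rewrite mulVf// subrr add0r oner_neq0.
  by rewrite addr0 subr_eq0 -(inj_eq (mulfI a0)) mulVKf// mulr1 dA.
have AWc : A *m col ord0 W = A ord0 ord0 *: col ord0 W.
  rewrite [in LHS]colE mulmxA -colE AW; apply/colP => s.
  by rewrite mul_mx_diag !mxE mulrC.
have Mc : M *m col ord0 W = delta_mx ord0 ord0.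
  rewrite /M !mulmxDl mulNmx mul1mx -scalemxAl AWc scalerA mulVf// scale1r.
  rewrite subrr add0r; apply/colP => s; rewrite !mxE (bigD1 ord0)//= !mxE W1.
  rewrite mulr1 eqxx andbT big1 ?addr0// => r /negbTE r0.
  by rewrite !mxE r0 andbF mul0r.
have := mulKmx uM (col ord0 W); rewrite Mc -colE => /colP/(_ i).
by rewrite !mxE => <-.
Qed.

(** * Steering one more coordinate with one more block *)

Section Steering.
Variables (K : numFieldType) (n : nat) (A B W V : 'M[K]_n.+1).
Hypotheses (B_diag : is_diag_mx B) (trigW : is_trig_mx W) (trigV : is_trig_mx V).
Hypotheses (W1 : forall i, W i i = 1) (V1 : forall i, V i i = 1).
Hypotheses (VW : V *m W = 1%:M) (AW : A *m W = W *m diag_mx (\row_i A i i)).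
Hypotheses (A_neq0 : forall i, A i i != 0) (B_neq0 : forall i, B i i != 0).
Variables (k l : nat -> nat).
Hypothesis cvgA : forall s i : 'I_n.+1, (s < i)%N ->
  (A s s / A i i) ^+ l q @[q --> \oo] --> (0 : K).
Hypothesis cvgB : forall s i : 'I_n.+1, (s < i)%N ->
  (B i i / B s s) ^+ k q @[q --> \oo] --> (0 : K).

Local Notation relpow i q :=
  ((B i i / B ord0 ord0) ^+ k q * (A i i / A ord0 ord0) ^+ l q).

Lemma cvg_delta_ratio (s i : 'I_n.+1) : (s <= i)%N ->
  (A s s / A i i) ^+ l q @[q --> \oo] --> ((s == i)%:R : K).
Proof.
rewrite leq_eqVlt; have [/val_inj <- _|si /= /cvgA //] := eqVneq (val s) (val i).
  by rewrite eqxx divff//; under eq_fun do rewrite expr1n; exact: cvg_cst.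
by rewrite -val_eqE (negbTE si).
Qed.

(** For i > 0, a monomial B_i^k A_s^l with s <= i factors as (A_s / A_i)^l times
    B_0^k A_0^l, which is bounded, times the normalized monomial
    of index i, which tends to 0; only i = s = 0 survives. *)
Lemma first_step_cvg (t : K) (p : 'cV[K]_n.+1) :
  B ord0 ord0 ^+ k q * A ord0 ord0 ^+ l q @[q --> \oo] --> t ->
  (forall i : 'I_n.+1, (0 < i)%N -> relpow i q @[q --> \oo] --> (0 : K)) ->
  B ^+ k q *m (A ^+ l q *m p) @[q --> \oo] -->
    (t * p ord0 ord0) *: (delta_mx ord0 ord0 : 'cV[K]_n.+1).
Proof.
move=> ct crel; apply: cvg_mx => i j; rewrite {j}(ord1 j) !mxE eqxx andbT.
under eq_fun do rewrite (trig_power_entry _ _ _ _ B_diag VW AW).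
pose L s : K := if (s == i) && (i == ord0) then t else 0.
have -> : t * p ord0 ord0 * (i == ord0)%:R =
    \sum_s (L s * W i s * \sum_j V s j * p j ord0).
  rewrite (bigD1 i)//= [X in _ + X]big1 ?addr0 => [|s /negbTE si]; last first.
    by rewrite /L si /= !mul0r.
  rewrite /L eqxx /= W1 mulr1.
  case: eqVneq => [->|_]; last by rewrite mulr0 mul0r.
  rewrite mulr1 (bigD1 ord0)//= V1 mul1r big1 ?addr0// => s s0.
  by rewrite (is_trig_mxP trigV) ?mul0r// lt0n.
apply: (@cvg_big _ _ +%R 0) => [|s _]; first exact: add_continuous.
apply: cvgM; last exact: cvg_cst.
have [si|is_] := leqP s i; last first.
  rewrite (is_trig_mxP trigW)// mulr0; under eq_fun do rewrite mulr0.
  exact: cvg_cst.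
apply: cvgM; last exact: cvg_cst.
have [i0|i0] := eqVneq i ord0.
  have s0 : s = ord0.
    by apply/val_inj/eqP; rewrite -leqn0 -[0%N]/(val (@ord0 n)) -i0.
  by rewrite /L i0 s0 eqxx.
rewrite /L (negbTE i0) andbF.
have -> : 0 = (s == i)%:R * (t * 0) :> K by rewrite !mulr0.
under eq_fun => q do have -> : B i i ^+ k q * A s s ^+ l q =
  (A s s / A i i) ^+ l q * (B ord0 ord0 ^+ k q * A ord0 ord0 ^+ l q * relpow i q)
  by rewrite !expr_div_n; field; rewrite ?expf_neq0.
apply: cvgM; first exact: cvg_delta_ratio.
by apply: cvgM => //; apply: crel; rewrite lt0n.
Qed.

(** The vector y is P W g where P keeps the coordinates below m and g has
    the entries x_r / (B_r^k A_r^l) for r < m.  Without the projection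
    P, the image B^k W D^l V y = B^k W D^l g would tend to the coordinates of x
    below m and vanish beyond.  The projection changes V W = 1 into
    Q = V P W, which agrees with the identity on the rows below m and
    whose entry (m, 0) is - W_(m,0), whence the condition on t. *)
Lemma next_step_cvg (m : 'I_n.+1) (t : K) (x : 'cV[K]_n.+1) :
  m != ord0 ->
  relpow m q @[q --> \oo] --> t ->
  (forall i : 'I_n.+1, (m < i)%N -> relpow i q @[q --> \oo] --> (0 : K)) ->
  (forall i : 'I_n.+1, (0 < i < m)%N ->
    (relpow i q)^-1 @[q --> \oo] --> (0 : K)) ->
  (forall i : 'I_n.+1, (m < i)%N -> x i ord0 = 0) ->
  W m ord0 * t * x ord0 ord0 = - x m ord0 ->
  exists y : nat -> 'cV[K]_n.+1,
    (forall q (i : 'I_n.+1), (m <= i)%N -> y q i ord0 = 0) /\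
    B ^+ k q *m (A ^+ l q *m y q) @[q --> \oo] --> x.
Proof.
move=> m0 cm chi clo x0 xm.
pose g q r := x r ord0 / (B r r ^+ k q * A r r ^+ l q).
pose y q : 'cV[K]_n.+1 := \col_j
  (if (j < m)%N then \sum_(r < n.+1 | (r < m)%N) W j r * g q r else 0).
exists y; split => [q i|]; first by rewrite mxE ltnNge => ->.
(* The entries of V P W, where P is the projection on the coordinates below m. *)
pose Q s r := \sum_(j < n.+1 | (j < m)%N) V s j * W j r.
have VWE s r : \sum_j V s j * W j r = (s == r)%:R.
  by have /matrixP/(_ s r) := VW; rewrite !mxE.
have Qdelta (s r : 'I_n.+1) : (s < m)%N -> Q s r = (s == r)%:R.
  move=> sm; rewrite -VWE [RHS](bigID (fun j : 'I_n.+1 => (j < m)%N))/=.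
  rewrite [X in _ + X]big1 ?addr0// => j; rewrite -leqNgt => mj.
  by rewrite (is_trig_mxP trigV) ?mul0r// (leq_trans sm).
have Qm : Q m ord0 = - W m ord0.
  apply/eqP; rewrite -addr_eq0; apply/eqP; rewrite -[RHS]/((false)%:R).
  rewrite -(negbTE m0) -VWE [RHS](bigID (fun j : 'I_n.+1 => (j < m)%N))/=.
  congr (_ + _); rewrite (bigD1 m) ?ltnn//= V1 mul1r big1 ?addr0// => j.
  rewrite -leqNgt => /andP[mj jm]; rewrite (is_trig_mxP trigV) ?mul0r//.
  by rewrite ltn_neqAle mj eq_sym andbT.
(* Coefficient of x_r in the s-th summand of the i-th coordinate; L is its limit
   wherever W_(i,s) Q_(s,r) is nonzero. *)
pose H i s r q := B i i ^+ k q * A s s ^+ l q / (B r r ^+ k q * A r r ^+ l q).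
pose L (i s r : 'I_n.+1) : K :=
  if s == i then
    if (i < m)%N then 1 else if (i == m) && (r == ord0) then t else 0
  else 0.
have entryE i q : (B ^+ k q *m (A ^+ l q *m y q)) i ord0 =
    \sum_s \sum_(r < n.+1 | (r < m)%N) W i s * Q s r * x r ord0 * H i s r q.
  rewrite (trig_power_entry _ _ _ _ B_diag VW AW); apply: eq_bigr => s _.
  have -> : \sum_j V s j * y q j ord0 =
      \sum_(r < n.+1 | (r < m)%N) Q s r * g q r.
    under [RHS]eq_bigr do rewrite mulr_suml.
    rewrite exchange_big/= [RHS]big_mkcond/=; apply: eq_bigr => j _.
    rewrite mxE; case: ifP => _; last by rewrite mulr0.
    by rewrite mulr_sumr; apply: eq_bigr => r _; rewrite mulrA.
  rewrite mulr_sumr; apply: eq_bigr => r _.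
  by rewrite /H /g; field; rewrite ?expf_neq0.
have xE i : x i ord0 =
    \sum_s \sum_(r < n.+1 | (r < m)%N) W i s * Q s r * x r ord0 * L i s r.
  rewrite (bigD1 i)//= [X in _ + X]big1 ?addr0 => [|s /negbTE si]; last first.
    by rewrite big1// => r _; rewrite /L si mulr0.
  rewrite /L eqxx W1.
  have [im|mi|/val_inj im] := ltngtP i m.
  - rewrite (bigD1 i)//= big1 ?addr0 => [|r /andP[_ /negbTE ri]].
      by rewrite Qdelta// eqxx !(mul1r, mulr1).
    by rewrite Qdelta// eq_sym ri mulr0 !mul0r.
  - rewrite x0// big1// => r _.
    by rewrite -val_eqE /= gtn_eqF// mulr0.
  - rewrite im eqxx (bigD1 ord0) ?lt0n//= Qm.
    rewrite big1 ?addr0 => [|r /andP[_ /negbTE ->]].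
      by rewrite mul1r -[LHS]opprK -xm; ring.
    by rewrite mulr0.
apply: cvg_mx => i j; rewrite {j}(ord1 j) xE.
under eq_fun do rewrite entryE.
apply: (@cvg_big _ _ +%R 0) => [|s _]; first exact: add_continuous.
apply: (@cvg_big _ _ +%R 0) => [|r rm]; first exact: add_continuous.
have cvg_null c : c = 0 -> c * H i s r q @[q --> \oo] --> c * L i s r.
  move=> ->; rewrite mul0r; under eq_fun do rewrite mul0r; exact: cvg_cst.
have [si|is_] := leqP s i; last first.
  by apply: cvg_null; rewrite (is_trig_mxP trigW)// !mul0r.
have [sm|ms] := ltnP s m.
  have [<-|/negbTE sr] := eqVneq s r; last first.
    by apply: cvg_null; rewrite Qdelta// sr mulr0 mul0r.
  apply: cvgM; first exact: cvg_cst.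
  have -> : H i s s = fun q => (B i i / B s s) ^+ k q.
    by apply/funext => q; rewrite /H expr_div_n; field; rewrite !expf_neq0.
  move: si; rewrite leq_eqVlt /L -val_eqE /=.
  case: eqVneq => [/val_inj <- _|/= si /cvgB //].
  by rewrite sm divff//; under eq_fun do rewrite expr1n; exact: cvg_cst.
apply: cvgM; first exact: cvg_cst.
have -> : L i s r =
    (s == i)%:R * ((if i == m then t else 0) * (r == ord0)%:R).
  rewrite /L; case: eqVneq => [<-|_]; last by rewrite mul0r.
  rewrite ltnNge ms /= mul1r; case: eqP => _ /=; last by rewrite mul0r.
  by case: eqP => _; rewrite ?mulr1 ?mulr0.
have -> : H i s r =
    fun q => (A s s / A i i) ^+ l q * (relpow i q * (relpow r q)^-1).
  by apply/funext => q; rewrite /H !expr_div_n; field; rewrite !expf_neq0.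
apply: cvgM; first exact: cvg_delta_ratio.
apply: cvgM.
  case: eqVneq => [->//|im]; apply: chi.
  by rewrite ltn_neqAle eq_sym im (leq_trans ms si).
case: eqVneq => [->|r0]; last by apply: clo; rewrite lt0n r0.
rewrite !divff//; under eq_fun do rewrite !expr1n mul1r invr1.
exact: cvg_cst.
Qed.

End Steering.

(** * The points reached by a given number of blocks *)

(** The exponents are required to be positive because the identity need not belong
    to the semigroup generated by A and B. *)
Fixpoint layer (K : numFieldType) (n : nat) (A B : 'M[K]_n.+1) (p : 'cV[K]_n.+1)
    (m : nat) : set 'cV[K]_n.+1 :=
  if m is m'.+1 then
    [set x | exists k l y, [/\ (0 < k)%N, (0 < l)%N, layer A B p m' y &
                            x = B ^+ k *m (A ^+ l *m y)]]
  else [set p].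

Section Layers.
Variables (K : numFieldType) (n : nat) (A B : 'M[K]_n.+1) (p : 'cV[K]_n.+1).

Lemma closure_layer (k l m : nat) (y : 'cV[K]_n.+1) :
  (0 < k)%N -> (0 < l)%N -> closure (layer A B p m) y ->
  closure (layer A B p m.+1) (B ^+ k *m (A ^+ l *m y)).
Proof.
move=> k0 l0 /(@closure_mulmx _ _ _ _ (B ^+ k *m A ^+ l)); rewrite mulmxA.
apply: closureS => _ [z mz <-].
by exists k, l, z; rewrite mulmxA.
Qed.

Lemma layer_prod (m : nat) :
  layer A B p m `<=` [set x | exists u v : 'I_m -> nat,
    x = (\prod_(i < m) (B ^+ u i *m A ^+ v i)) *m p].
Proof.
elim: m => [|m IH] x /=.
  by move=> ->; exists (fun=> 0%N), (fun=> 0%N); rewrite big_ord0 mul1mx.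
move=> [k [l [y [_ _ /IH[u [v ->]] ->]]]].
exists (fun i => oapp u k (unlift ord0 i)), (fun i => oapp v l (unlift ord0 i)).
rewrite big_ord_recl unlift_none /=.
under [X in _ = _ * X *m _]eq_bigr do rewrite liftK /=.
by rewrite -mulmxE !mulmxA.
Qed.

Lemma layer_orbit (m : nat) :
  layer A B p m.+1 `<=` mx_orbit (mx_semigroup [set A; B]) p.
Proof.
have SM X Y : mx_semigroup [set A; B] X -> mx_semigroup [set A; B] Y ->
    mx_semigroup [set A; B] (X *m Y).
  by move=> SX SY G CG; apply: (CG.1); [exact: SX|exact: SY].
have SA : mx_semigroup [set A; B] A by move=> G [_]; apply; left.
have SB : mx_semigroup [set A; B] B by move=> G [_]; apply; right.
have SX X k : mx_semigroup [set A; B] X -> (0 < k)%N ->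
    mx_semigroup [set A; B] (X ^+ k).
  move=> SX; case: k => // k _; elim: k => [|k IH]; first by rewrite expr1.
  by rewrite exprS; apply: SM.
elim: m => [|m IH] x [k [l [y [k0 l0 + ->]]]].
  move=> -> /=; exists (B ^+ k *m A ^+ l); rewrite ?mulmxA//.
  by apply: SM; exact: SX.
move=> /IH[T ST <-]; exists (B ^+ k *m A ^+ l *m T); last by rewrite !mulmxA.
by apply: (SM) => //; apply: SM; exact: SX.
Qed.

End Layers.

(** * Density *)

Lemma ord_chain (n : nat) (P : 'I_n.+1 -> 'I_n.+1 -> Prop) :
  (forall i j s, P i j -> P j s -> P i s) ->
  (forall i j : 'I_n.+1, j = i.+1 :> nat -> P i j) ->
  forall i j : 'I_n.+1, (i < j)%N -> P i j.
Proof.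
move=> Ptrans Pnext i [j jn]; elim: j jn => [|j IH] jn //=.
rewrite ltnS leq_eqVlt => /orP[/eqP ij|ij].
  by apply: Pnext => /=; rewrite ij.
by apply: (Ptrans _ (Ordinal (ltnW jn))); [exact: IH|exact: Pnext].
Qed.

Theorem theorem1p3 (R : realType) (k : scalar_kind) (n : nat)
    (A B : 'M[base_field R k]_n.+1)
    (A_lower : is_trig_mx A) (B_diag : is_diag_mx B)
    (B_pos : 0 < modulus (B ord_max ord_max))
    (B_decr : forall i j : 'I_n.+1, j = i.+1 :> nat ->
       modulus (B j j) < modulus (B i i))
    (B_lt1 : modulus (B ord0 ord0) < 1)
    (A_gt1 : 1 < modulus (A ord0 ord0))
    (A_incr : forall i j : 'I_n.+1, j = i.+1 :> nat ->
       modulus (A i i) < modulus (A j j))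
    (prec_chain : forall i j : 'I_n.+1, j = i.+1 :> nat ->
       pair_prec (diag_pair A B j) (diag_pair A B i))
    (gen_dim1 : n.+1 = 1%N -> generating_pair (B ord0 ord0) (A ord0 ord0))
    (inv_col : forall i : 'I_n.+1,
       (invmx ((A ord0 ord0)^-1 *: A - 1%:M + delta_mx ord0 ord0)) i ord0 != 0) :
  forall p : 'cV[base_field R k]_n.+1, p ord0 ord0 != 0 ->
    dense (mx_orbit (mx_semigroup [set A; B]) p) /\
    dense [set x : 'cV[base_field R k]_n.+1 |
      exists u v : 'I_n.+1 -> nat,
        x = (\prod_(i < n.+1) (B ^+ u i *m A ^+ v i)) *m p].
Proof.
move=> p p0; pose K := base_field R k.
have modB (i j : 'I_n.+1) : (i < j)%N -> modulus (B j j) < modulus (B i i).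
  apply: (ord_chain (P := fun i j => modulus (B j j) < modulus (B i i)) _ B_decr).
  by move=> a b c ab bc; exact: lt_trans bc ab.
have modA (i j : 'I_n.+1) : (i < j)%N -> modulus (A i i) < modulus (A j j).
  apply: (ord_chain (P := fun i j => modulus (A i i) < modulus (A j j)) _ A_incr).
  by move=> a b c; exact: lt_trans.
have prec (i j : 'I_n.+1) : (i < j)%N ->
    pair_prec (diag_pair A B j) (diag_pair A B i).
  apply: (ord_chain
    (P := fun i j => pair_prec (diag_pair A B j) (diag_pair A B i)) _ prec_chain).
  by move=> a b c [gb ga ba] [gc _ cb]; split=> //; exact: lt_trans cb ba.
have Bgt0 i : 0 < modulus (B i i).
  have := leq_ord i; rewrite leq_eqVlt => /orP[im|im].
    by have -> : i = ord_max by exact/val_inj/eqP.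
  by apply: lt_trans B_pos (modB i ord_max im).
have Agt1 i : 1 < modulus (A i i).
  have [->//|i0] := eqVneq i ord0.
  by apply: lt_trans A_gt1 (modA _ _ _); rewrite lt0n.
have modulus_gt0_neq0 (z : K) : 0 < modulus z -> z != 0.
  by rewrite -modulus_eq0 => /gt_eqF ->.
have B0 i : B i i != 0 by exact: modulus_gt0_neq0.
have A0 i : A i i != 0 by apply: modulus_gt0_neq0; exact: lt_trans (Agt1 i).
have gen i : generating_pair (diag_pair A B i).1 (diag_pair A B i).2.
  have [i0|i0] := posnP i; last by have [] := prec ord0 i i0.
  have -> : i = ord0 by exact/val_inj.
  have [n0|n0] := posnP n.
    by rewrite /diag_pair eqxx; apply: gen_dim1; rewrite n0.
  by have [] := prec ord0 ord_max n0.
have dp1 i : 0 < modulus (diag_pair A B i).1.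
  rewrite /diag_pair; case: eqP => _ //=.
  by rewrite modulusM modulusV divr_gt0.
have dp2 i : 1 < modulus (diag_pair A B i).2.
  rewrite /diag_pair; case: eqVneq => i0 //=.
  rewrite modulusM modulusV ltr_pdivlMr ?mul1r ?(lt_trans _ A_gt1)//.
  by apply: modA; rewrite lt0n.
have dpE i : i != ord0 ->
    diag_pair A B i = (B i i / B ord0 ord0, A i i / A ord0 ord0).
  by rewrite /diag_pair => /negbTE ->.
have neqA (i j : 'I_n.+1) : (i < j)%N -> A i i != A j j.
  by move=> ij; apply: contraTneq (modA i j ij) => ->; rewrite ltxx.
have [W [V [[trigW trigV] W1 V1 VW AW]]] := trig_diagonalize A_lower neqA.
have Wcol i : W i ord0 != 0.
  rewrite (first_col_invmx A_lower (A0 _) _ AW (W1 _))// => j j0.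
  by rewrite eq_sym neqA// lt0n.
have cvgA (l : nat -> nat) (s i : 'I_n.+1) :
    (forall q, q < l q)%N -> (s < i)%N ->
    (A s s / A i i) ^+ l q @[q --> \oo] --> (0 : K).
  move=> ql si; apply: cvg_expr_modulus => //.
  rewrite modulusM modulusV ltr_pdivrMr ?mul1r ?modA//.
  exact: lt_trans (Agt1 i).
have cvgB (l : nat -> nat) (s i : 'I_n.+1) :
    (forall q, q < l q)%N -> (s < i)%N ->
    (B i i / B s s) ^+ l q @[q --> \oo] --> (0 : K).
  move=> ql si; apply: cvg_expr_modulus => //.
  by rewrite modulusM modulusV ltr_pdivrMr ?mul1r ?modB.
have seq_exists (i : 'I_n.+1) (t : K) : exists kl : nat -> nat * nat,
    [/\ forall q, (q < (kl q).1)%N, forall q, (q < (kl q).2)%N &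
     [/\ (diag_pair A B i).1 ^+ (kl q).1 * (diag_pair A B i).2 ^+ (kl q).2
         @[q --> \oo] --> t,
      forall j : 'I_n.+1, (i < j)%N ->
        (B j j / B ord0 ord0) ^+ (kl q).1 * (A j j / A ord0 ord0) ^+ (kl q).2
        @[q --> \oo] --> (0 : K) &
      t != 0 -> forall j : 'I_n.+1, (0 < j < i)%N ->
        ((B j j / B ord0 ord0) ^+ (kl q).1 *
         (A j j / A ord0 ord0) ^+ (kl q).2)^-1
        @[q --> \oo] --> (0 : K)]].
  have dp2' : (diag_pair A B i).2 != 0.
    by apply: modulus_gt0_neq0; exact: lt_trans (dp2 i).
  have [kl [klq klt]] :=
    generating_seq t (modulus_gt0_neq0 _ (dp1 i)) dp2' (gen i).
  exists kl; split; [by move=> q; case/andP: (klq q)..|split=> //].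
    move=> j ij; have j0 : j != ord0 by rewrite -lt0n (leq_ltn_trans _ ij).
    have [_ _ pji] := prec _ _ ij.
    have := prec_cvg0 (dp1 i) (dp2 i) (dp1 j) (dp2 j) pji klq klt.
    by rewrite dpE.
  move=> t0 j /andP[j0 ji].
  have [_ _ pij] := prec _ _ ji.
  have := prec_cvgV0 (dp1 j) (dp2 j) (dp1 i) (dp2 i) pij klq t0 klt.
  by rewrite dpE// -lt0n.
have reach (m : nat) : (m <= n)%N -> forall x : 'cV[K]_n.+1,
    (forall i : 'I_n.+1, (m < i)%N -> x i ord0 = 0) ->
    closure (layer A B p m.+1) x.
  elim: m => [_ x x0|m IH mn].
    have [kl [kq lq [ct chi _]]] := seq_exists ord0 (x ord0 ord0 / p ord0 ord0).
    apply: (@closure_seq _ _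
      (fun q => B ^+ (kl q).1 *m (A ^+ (kl q).2 *m p))).
      move=> q; apply: closure_layer.
      - exact: leq_ltn_trans (kq q).
      - exact: leq_ltn_trans (lq q).
      - exact: subset_closure.
    have -> : x = (x ord0 ord0 / p ord0 ord0 * p ord0 ord0) *:
        (delta_mx ord0 ord0 : 'cV[K]_n.+1).
      apply/colP => i; rewrite !mxE divfK// andbT.
      have [->|i0] := eqVneq i ord0; first by rewrite mulr1.
      by rewrite mulr0 x0// lt0n.
    apply: (first_step_cvg B_diag trigW trigV W1 V1 VW AW A0 B0 _ _ chi).
      by move=> s i; exact: cvgA.
    by move: ct; rewrite /diag_pair eqxx.
  pose M : 'I_n.+1 := Ordinal (mn : (m.+1 < n.+1)%N).
  have M0 : M != ord0 by [].
  have generic (x : 'cV[K]_n.+1) : x ord0 ord0 != 0 -> x M ord0 != 0 ->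
      (forall i : 'I_n.+1, (M < i)%N -> x i ord0 = 0) ->
      closure (layer A B p m.+2) x.
    move=> x00 xM x0.
    (* The limit prescribed by the condition on t in next_step_cvg. *)
    pose t := - x M ord0 / (W M ord0 * x ord0 ord0).
    have t0 : t != 0 by rewrite mulf_neq0 ?oppr_eq0// invr_eq0 mulf_neq0.
    have [kl [kq lq [ct chi clo]]] := seq_exists M t.
    rewrite dpE//= in ct.
    have Wt : W M ord0 * t * x ord0 ord0 = - x M ord0.
      by rewrite mulrAC mulrC divfK// mulf_neq0.
    have [y [y0 cy]] := next_step_cvg B_diag trigW trigV W1 V1 VW AW A0 B0
      (fun s i => @cvgA _ s i lq) (fun s i => @cvgB _ s i kq)
      M0 ct chi (clo t0) x0 Wt.
    apply: (closure_seq _ cy) => q.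
    apply: closure_layer.
    - exact: leq_ltn_trans (kq q).
    - exact: leq_ltn_trans (lq q).
    - by apply: IH => [|i mi]; [exact: ltnW|exact: y0].
  (* The vanishing coordinates 0 and m + 1 of x are replaced by nonzero ones
     tending to 0, in order to be in the generic case. *)
  move=> x x0.
  pose nudge q (i : 'I_n.+1) : K :=
    if (x i ord0 == 0) && ((i == ord0) || (i == M)) then B ord0 ord0 ^+ q.+1
    else 0.
  apply: (@closure_seq _ _ (fun q => \col_i (x i ord0 + nudge q i))) => [q|].
    apply: generic => [||i Mi]; rewrite mxE /nudge ?eqxx ?orbT ?andbT.
    - by case: (eqVneq (x ord0 ord0) 0) => [->|]; rewrite ?addr0// add0r expf_neq0.
    - by case: (eqVneq (x M ord0) 0) => [->|]; rewrite ?addr0// add0r expf_neq0.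
    - rewrite x0// -!val_eqE /= (gtn_eqF Mi) gtn_eqF ?andbF ?addr0//.
      exact: leq_ltn_trans Mi.
  apply: cvg_mx => i j; rewrite {j}(ord1 j) -[X in _ --> X]addr0.
  under eq_fun do rewrite mxE.
  apply: cvgD; first exact: cvg_cst.
  rewrite /nudge; case: (_ && _); last exact: cvg_cst.
  exact: (@cvg_expr_modulus _ _ _ S).
have dense_layer (S : set 'cV[K]_n.+1) : layer A B p n.+1 `<=` S -> dense S.
  move=> LS O [x Ox] openO.
  have [|y [Ly Oy]] := reach n (leqnn n) x _ _ (open_nbhs_nbhs (conj openO Ox)).
    by move=> i; rewrite ltnNge -ltnS ltn_ord.
  by exists y; split => //; exact: LS.
by split; apply: dense_layer; [exact: layer_orbit|exact: layer_prod].
Qed.
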